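(* Let $n\ge1$. If $H$ is dense in $\widehat{\mathcal F_n}$, then every $\sqcap$-irreducible element of $H$ remains $\sqcap$-irreducible in $\widehat{\mathcal F_n}$.
   Context: Fix $n\ge1$ and symbols $P_1,\dots,P_n$. The partially ordered set $(K_n,\le)$ with valuation map $\mathrm{val}:K_n\to\mathfrak P(\{P_1,\dots,P_n\})$ is the increasing union of finite sets $K_n^d$ ($d\ge 0$) built recursively: $K_n^{-1}=\emptyset$, and $K_n^d\setminus K_n^{d-1}$ consists of exactly one point $w_{\beta,Y}$ for each pair $(\beta,Y)$ such that (i) $Y$ is a decreasing subset of $K_n^{d-1}$ with $Y\not\subseteq K_n^{d-2}$ (for $d=0$ this last condition is void, so $Y=\emptyset$); (ii) $\beta\subseteq\{P_1,\dots,P_n\}$ and $\beta\subseteq\mathrm{val}(w')$ for all $w'\in Y$; (iii) if $Y$ is the decreasing set generated by a single element $w_{\beta',Y'}$, then $\beta\ne\beta'$. One sets $\mathrm{val}(w_{\beta,Y})=\beta$, and $w\le w_{\beta,Y}$ iff $w\in Y$ or $w=w_{\beta,Y}$. $\widehat{\mathcal F_n}:=\mathcal O_\downarrow(K_n,\le)$ is the Heyting algebra of all decreasing subsets of $K_n$ ($\sqcap=\cap$, $\sqcup=\cup$, $a\to b$ = the largest decreasing set contained in $(K_n\setminus a)\cup b$). It carries the metric $\mathrm d(a,b)=2^{-\min\{i\in\mathbb N\mid a\cap K_n^i\neq b\cap K_n^i\}}$ ($2^{-\min\emptyset}=0$). ''$H$ is dense in $\widehat{\mathcal F_n}$'' means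 that $H$ is a Heyting sub-algebra of $\widehat{\mathcal F_n}$ that is dense for this metric. An element $a$ of a lattice is $\sqcap$-irreducible if $a\ne1$ and $a$ cannot be written as $b_1\sqcap b_2$ with $b_1\neq a$ and $b_2\ne a$. *)

(* Defs.v *)
From HB Require Import structures.
From mathcomp Require Import all_boot all_order all_algebra finmap.
From mathcomp Require Import all_classical all_reals all_analysis.

Set Implicit Arguments.
Unset Strict Implicit.
Unset Printing Implicit Defensive.

Import Order.TTheory GRing.Theory Num.Theory.

Local Open Scope classical_set_scope.

(* P_1, ..., P_n are represented by 'I_n.  The point w_{beta,Y} is represented
   by a natural number coding the pair (beta, Y), where Y is a finite set of
   (codes of) points; the coding is injective, so distinct pairs give distinct
   points. *)
Section Points.
Variable n : nat.

Definition node (beta : {set 'I_n}) (Y : {fset nat}) : nat := choice.pickle (beta, Y).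

Definition label (w : nat) : {set 'I_n} * {fset nat} :=
  odflt (finset.set0, fset0) (choice.unpickle w).

Lemma nodeK beta Y : label (node beta Y) = (beta, Y).
Proof. by rewrite /label /node choice.pickleK. Qed.

Definition code_val (w : nat) : {set 'I_n} := (label w).1.

Definition code_le (w w' : nat) : bool := (w \in (label w').2) || (w == w').

Local Open Scope fset_scope.

Definition down_closed_in (A Y : {fset nat}) : bool :=
  (Y `<=` A) && [forall w : A, forall w' : A,
    (fsval w' \in Y) && code_le (fsval w) (fsval w') ==> (fsval w \in Y)].

(* Conditions (i), (ii) and (iii) on (beta, Y), with A = K_n^{d-1}; [B] is
   [Some K_n^{d-2}] for d >= 1 and [None] for d = 0. *)
Definition admissible (B : option {fset nat}) (A : {fset nat})
    (beta : {set 'I_n}) (Y : {fset nat}) : bool :=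
  [&& down_closed_in A Y,
      (if B is Some B' then ~~ (Y `<=` B') else true),
      [forall w : A, (fsval w \in Y) ==> (beta \subset code_val (fsval w))] &
      [forall w : A, (Y == [fset v in A | code_le v (fsval w)]) ==>
                     (beta != code_val (fsval w))]].

Definition new_points (B : option {fset nat}) (A : {fset nat}) : {fset nat} :=
  [fset w in [seq node p.1 p.2 |
    p <- [seq (beta, Y) | beta <- enum {: {set 'I_n}},
                          Y <- enum_fset (fpowerset A)]
    & admissible B A p.1 p.2]].

(* [layer d] is K_n^d; the inner match supplies K_n^{d-2}, with
   K_n^{-1} = fset0. *)
Fixpoint layer (d : nat) : {fset nat} :=
  match d with
  | 0 => new_points None fset0
  | d'.+1 =>
      layer d' `|`
      new_points (Some (match d' with 0 => fset0 | e.+1 => layer e end))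
                 (layer d')
  end.

Definition layer_pred (d : nat) : {fset nat} :=
  if d is e.+1 then layer e else fset0.

Definition layer_pred2 (d : nat) : option {fset nat} :=
  if d is e.+1 then Some (layer_pred e) else None.

Lemma layerE d :
  layer d = layer_pred d `|` new_points (layer_pred2 d) (layer_pred d).
Proof. by case: d => [|[|d]] //=; rewrite fset0U. Qed.

Lemma new_pointsP B A w :
  reflect (exists beta Y, admissible B A beta Y /\ w = node beta Y)
          (w \in new_points B A).
Proof.
rewrite inE; apply: (iffP mapP) => [[[b Y]]|[b [Y [adm ->]]]].
  by rewrite mem_filter /= => /andP[adm _] ->; exists b, Y.
exists (b, Y) => //; rewrite mem_filter /= adm /=.
apply/allpairsP; exists (b, Y); split => //=; first by rewrite mem_enum.
by have -> : (Y \in fpowerset A); rewrite // fpowersetE; case/and4P: adm => /andP[].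
Qed.

Lemma layerS d w : w \in layer d -> w \in layer d.+1.
Proof. by move=> wd; rewrite layerE inE wd. Qed.

Lemma layer_mono d e : (d <= e)%N -> layer d `<=` layer e.
Proof.
move=> /subnK <-; elim: (e - d)%N => [|k IH]; first exact: fsubset_refl.
by apply: (fsubset_trans IH); apply/fsubsetP => w; exact: layerS.
Qed.

Lemma layer_predS d : layer_pred d `<=` layer d.
Proof. by rewrite [layer d]layerE fsubsetUl. Qed.

Lemma new_layer d w : w \in layer d -> exists2 e, (e <= d)%N &
  w \in new_points (layer_pred2 e) (layer_pred e).
Proof.
elim: d => [|d IH]; rewrite layerE in_fsetU => /orP[].
- by rewrite in_fset0.
- by exists 0%N.
- by move=> /IH[e ed we]; exists e => //; apply: leqW.
- by exists d.+1.
Qed.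

Lemma below_layer d w : w \in layer d -> (label w).2 `<=` layer_pred d.
Proof.
move=> /new_layer[e ed /new_pointsP[b [Y [/and4P[/andP[YA _] _ _ _] ->]]]].
rewrite nodeK /=; apply: (fsubset_trans YA).
case: e d ed {YA} => [|e] [|d] ed; [exact: fsub0set|exact: fsub0set|by []|].
exact: layer_mono.
Qed.

Lemma mem_layerD d beta Y :
  (node beta Y \in layer d `\` layer_pred d) =
  admissible (layer_pred2 d) (layer_pred d) beta Y.
Proof.
rewrite in_fsetD [layer d]layerE in_fsetU; apply/andP/idP => [[/negbTE->]|adm].
  move=> /new_pointsP[b [Z [adm E]]].
  by have := nodeK beta Y; rewrite E nodeK => -[<- <-].
have -> : node beta Y \in new_points (layer_pred2 d) (layer_pred d).
  by apply/new_pointsP; exists beta, Y.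
rewrite orbT; split=> //; case: d adm => [|d] /and4P[_ YB _ _]; first by [].
by apply: contra YB => /below_layer; rewrite nodeK.
Qed.

Lemma below_trans d w1 w2 w3 : w3 \in layer d ->
  w2 \in (label w3).2 -> w1 \in (label w2).2 -> w1 \in (label w3).2.
Proof.
move=> /new_layer[e ed /new_pointsP[b [Y [/and4P[/andP[YA dY] _ _ _] ->]]]].
rewrite nodeK /= => w2Y w12.
have w2A : w2 \in layer_pred e by apply: (fsubsetP YA).
have w1A : w1 \in layer_pred e.
  case: e ed YA dY w2A => [|e] //= ed YA dY w2A.
  have := fsubsetP (below_layer w2A) _ w12.
  exact: (fsubsetP (layer_predS e)).
move/forallP/(_ [` w1A])/forallP/(_ [` w2A]): dY.
by rewrite /= w2Y /code_le w12 => /implyP; apply.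
Qed.

Lemma below_irr d w : w \in layer d -> w \notin (label w).2.
Proof.
elim: d => [|d IH] wd; apply/negP => ww.
  by have := fsubsetP (below_layer wd) _ ww.
by have := IH (fsubsetP (below_layer wd) _ ww); rewrite ww.
Qed.

End Points.

Definition in_K (n : nat) : pred nat := fun w => `[< exists d, w \in layer n d >].

Definition K (n : nat) : Type := {w : nat | in_K n w}.
HB.instance Definition _ n := SubType.on (K n).
HB.instance Definition _ n := [Choice of K n by <:].

Definition K_val n (w : K n) : {set 'I_n} := code_val n (val w).

Definition K_layer n (d : nat) : set (K n) := [set w | val w \in layer n d].

Definition K_le n : rel (K n) := fun w w' => code_le n (val w) (val w').

Lemma K_le_refl n : reflexive (@K_le n).
Proof. by move=> w; rewrite /K_le /code_le eqxx orbT. Qed.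

Lemma K_le_anti n : antisymmetric (@K_le n).
Proof.
move=> w w' /andP[/orP[ww'|/eqP/val_inj//] /orP[w'w|/eqP/val_inj//]].
have /asboolP[d wd] := valP w.
by have := below_trans wd w'w ww'; rewrite (negbTE (below_irr wd)).
Qed.

Lemma K_le_trans n : transitive (@K_le n).
Proof.
move=> w2 w1 w3 /orP[w12|/eqP/val_inj->//] /orP[w23|/eqP/val_inj<-];
  last by rewrite /K_le /code_le w12.
have /asboolP[d wd] := valP w3.
by rewrite /K_le /code_le (below_trans wd w23 w12).
Qed.

Fact K_display : Order.disp_t. Proof. exact: Order.Disp tt tt. Qed.

HB.instance Definition _ n := Order.Le_isPOrder.Build K_display (K n)
  (@K_le_refl n) (@K_le_anti n) (@K_le_trans n).

Definition decreasing_set d (T : porderType d) (a : set T) : Prop :=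
  forall x y, a y -> (x <= y)%O -> a x.

Definition decreasing n : {pred set (K n)} :=
  fun a => `[< decreasing_set a >].
Arguments decreasing : clear implicits.

Definition Fhat (n : nat) : Type := {a : set (K n) | a \in decreasing n}.
HB.instance Definition _ n := SubType.on (Fhat n).
HB.instance Definition _ n := [Choice of Fhat n by <:].

Lemma decreasing_meet n :
  {in decreasing n &, forall a b, (a `&` b)%O \in decreasing n}.
Proof.
move=> a b /asboolP da /asboolP db; apply/asboolP => x y [ay bya] xy.
by split; [exact: da xy|exact: db xy].
Qed.

Lemma decreasing_join n :
  {in decreasing n &, forall a b, (a `|` b)%O \in decreasing n}.
Proof.
move=> a b /asboolP da /asboolP db; apply/asboolP => x y [ay|bya] xy.
  by left; exact: da xy.
by right; exact: db xy.
Qed.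

Lemma decreasing_bot n : (\bot : set (K n))%O \in decreasing n.
Proof. by apply/asboolP. Qed.

Lemma decreasing_top n : (\top : set (K n))%O \in decreasing n.
Proof. by apply/asboolP. Qed.

Fact Fhat_display : Order.disp_t. Proof. exact: Order.Disp tt tt. Qed.

HB.instance Definition _ n :=
  Order.SubChoice_isTBSubLattice.Build _ _ _ Fhat_display (Fhat n)
    (@decreasing_meet n) (@decreasing_join n)
    (@decreasing_bot n) (@decreasing_top n).

Lemma decreasing_imp n (a b : set (K n)) :
  \bigcup_(c in [set c | decreasing_set c /\ c `<=` ~` a `|` b]) c
    \in decreasing n.
Proof.
by apply/asboolP => x y [c [dc cab] cy] xy; exists c => //; exact: dc xy.
Qed.

Definition himp n (a b : Fhat n) : Fhat n :=
  Sub (\bigcup_(c in [set c | decreasing_set c /\ c `<=` ~` val a `|` val b]) c)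
    (decreasing_imp (val a) (val b)).

Lemma le_himp n (a b c : Fhat n) : (c <= himp a b)%O = (c `&` a <= b)%O.
Proof.
apply/idP/idP => [/subsetPset cab|/subsetPset cab]; apply/subsetPset.
  by move=> x [/cab[e [_ eab] /eab[]]].
move=> x cx; exists (val c) => //; split; first exact/asboolP/(valP c).
move=> y cy; case: (pselect (val a y)) => ay; last by left.
by right; apply: cab.
Qed.

Definition heyting_subalgebra n (H : set (Fhat n)) : Prop :=
  [/\ H \bot%O, H \top%O,
      forall a b, H a -> H b -> H (a `&` b)%O,
      forall a b, H a -> H b -> H (a `|` b)%O &
      forall a b, H a -> H b -> H (himp a b)].

(* [S] is a sublattice of [L] and irreducibility is that of the lattice [S]. *)
Definition meet_irreducible_in d (L : tbLatticeType d) (S : set L) (a : L) :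
    Prop :=
  [/\ S a, a <> \top%O &
      ~ exists b1 b2, [/\ S b1, S b2, b1 <> a, b2 <> a & a = (b1 `&` b2)%O]].

(* A copy of [Fhat n]: the real field [R] has to appear in the type for the
   metric structure to be inferred. *)
Definition Fhat_metric (R : realType) (n : nat) : Type := Fhat n.

Section Metric.
Variables (R : realType) (n : nat).
Implicit Types a b c : Fhat n.
Local Open Scope ring_scope.

Definition differ_at a b : pred nat :=
  fun i => `[< val a `&` K_layer i <> val b `&` K_layer i >].

Definition Fhat_dist a b : R :=
  if pselect (exists i, differ_at a b i) is left h then 2 ^- ex_minn h else 0.

Lemma Fhat_dist_lt a b (i : nat) :
  Fhat_dist a b < 2 ^- i <-> forall j, (j <= i)%N -> ~~ differ_at a b j.
Proof.
rewrite /Fhat_dist; case: pselect => [h|h]; last first.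
  split=> [_ j _|_]; last by rewrite invr_gt0 exprn_gt0.
  by apply/negP => dj; apply: h; exists j.
case: ex_minnP => m dm minm; rewrite ltf_pV2 ?posrE ?exprn_gt0 //.
rewrite ltr_eXn2l ?ltr1n//; split=> [im j ji|/(_ m)].
  by apply/negP => /minm; rewrite leqNgt (leq_ltn_trans ji im).
by move=> dN; rewrite ltnNge; apply/negP => /dN; rewrite dm.
Qed.

Lemma Fhat_distxx a : Fhat_dist a a = 0.
Proof.
rewrite /Fhat_dist; case: pselect => // h.
by exfalso; case: h => i /asboolP.
Qed.

Lemma Fhat_dist_ge0 a b : 0 <= Fhat_dist a b.
Proof.
by rewrite /Fhat_dist; case: pselect => // h; rewrite invr_ge0 exprn_ge0.
Qed.

Lemma Fhat_dist_eq0 a b : Fhat_dist a b = 0 -> a = b.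
Proof.
rewrite /Fhat_dist; case: pselect => [h /eqP|h _].
  by rewrite invr_eq0 expf_eq0 pnatr_eq0 andbF.
have E i : val a `&` K_layer i = val b `&` K_layer i.
  by apply: contrapT => di; apply: h; exists i; apply/asboolP.
apply: val_inj; apply/seteqP; split=> x; have /asboolP[d xd] := valP x.
  by move=> ax; have : (val a `&` K_layer d) x by []; rewrite E => -[].
by move=> bx; have : (val b `&` K_layer d) x by []; rewrite -E => -[].
Qed.

Lemma Fhat_dist_sym a b : Fhat_dist a b = Fhat_dist b a.
Proof.
have E : differ_at a b = differ_at b a.
  by apply/funext => i; apply/asbool_equiv_eq; split=> + /esym.
by rewrite /Fhat_dist E.
Qed.

Lemma Fhat_dist_triangle b a c :
  Fhat_dist a c <= Fhat_dist a b + Fhat_dist b c.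
Proof.
rewrite {1}/Fhat_dist; case: pselect => [h|_]; last first.
  by rewrite addr_ge0 ?Fhat_dist_ge0.
case: ex_minnP => m dm _; rewrite leNgt; apply/negP => lt_m.
have /Fhat_dist_lt/(_ m (leqnn m))/asboolPn/contrapT Eab : Fhat_dist a b < 2 ^- m.
  by apply: le_lt_trans lt_m; rewrite lerDl Fhat_dist_ge0.
have /Fhat_dist_lt/(_ m (leqnn m))/asboolPn/contrapT Ebc : Fhat_dist b c < 2 ^- m.
  by apply: le_lt_trans lt_m; rewrite lerDr Fhat_dist_ge0.
by move/asboolP: dm; apply; rewrite Eab.
Qed.

HB.instance Definition _ := Choice.on (Fhat_metric R n).
HB.instance Definition _ := isMetric.Build R (Fhat_metric R n)
  Fhat_distxx Fhat_dist_eq0 Fhat_dist_sym Fhat_dist_triangle.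

End Metric.

Definition dense_in_Fhat (R : realType) n (H : set (Fhat n)) : Prop :=
  heyting_subalgebra H /\ @dense (Fhat_metric R n) H.

(* Main.v *)
(** Every point of K outside K^d lies above a point of K^{d+1} \ K^d.  Hence an
    element of Fhat agreeing on K^{d+1} with a decreasing subset [c] of K^d is
    equal to [c], so [c] is an isolated point and belongs to every dense [H];
    in particular [H] contains all principal decreasing sets.  If
    [a = b1 `&` b2] with [w1] in [b1] and [w2] in [b2] both outside [a], then
    [a] is also the meet of its joins with the principal decreasing sets of
    [w1] and [w2], and these joins belong to [H]. *)

Require Import Defs.
From mathcomp Require Import all_boot all_order all_algebra finmap.
From mathcomp Require Import all_classical all_reals all_analysis.

Import Order.TTheory GRing.Theory Num.Theory.

(** Descent one layer at a time: a point new in K^{d+k+1} has, by the second half of condition (i),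
    an element of its [Y] that is new in K^{d+k}. *)
Lemma exists_below_layer_diff (n d w k : nat) :
  w \in layer n (d + k) -> w \notin layer_pred n (d + k) ->
  exists v, [/\ v \in layer n d, v \notin layer_pred n d & code_le n v w].
Proof.
elim: k w => [|k IH] w; first by rewrite addn0 => wd wp; exists w;
    rewrite /code_le eqxx orbT.
rewrite addnS /= -/(layer n (d + k).+1) => wd wp.
have := wd; rewrite layerE in_fsetU /= (negbTE wp) /=.
case/new_pointsP => b [Y [adm wE]].
case/and4P: adm => /andP[YA _] /fsubsetPn[v vY vp] _ _.
have [u [ud up uv]] := IH v (fsubsetP YA _ vY) vp.
exists u; split=> //; case/orP: uv => [uv|/eqP ->]; rewrite /code_le wE nodeK /=.
  have wY : (label n w).2 = Y by rewrite wE nodeK.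
  by rewrite -wY (below_trans wd _ uv) ?wY.
by rewrite vY.
Qed.

Lemma outside_layer_above_diff (n d : nat) (x : K n) :
  ~ K_layer d x -> exists y : K n, [/\ K_layer d.+1 y, ~ K_layer d y & (y <= x)%O].
Proof.
move=> xd; have /asboolP ex_layer := valP x.
(* Minimality of [m] makes [x] new in K^m, which is where the descent to K^{d+1} starts. *)
case: (ex_minnP ex_layer) => m xm min_m.
have lt_dm : (d < m)%N.
  rewrite ltnNge; apply/negP => md; apply: xd.
  exact: (fsubsetP (layer_mono n md)) xm.
have [||v [vd vp vx]] := @exists_below_layer_diff n d.+1 (val x) (m - d.+1).
- by rewrite subnKC.
- rewrite subnKC //; case: m {xm} min_m lt_dm => // m min_m _ /=.
  by apply/negP => /min_m; rewrite ltnn.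
have vK : in_K n v by apply/asboolP; exists d.+1.
by exists (Sub v vK); rewrite /K_layer /=; split=> //; exact/negP.
Qed.

Lemma eq_on_layer_isolated (n d : nat) (c h : Fhat n) :
  (val c `<=` K_layer d)%classic ->
  (val h `&` K_layer d.+1 = val c `&` K_layer d.+1)%classic -> h = c.
Proof.
move=> cd E.
(* A point of [h] outside K^d would force into [h], hence into [c], a point of K^{d+1} outside
   K^d. *)
have hd x : val h x -> K_layer d x.
  move=> hx; apply: contrapT => /outside_layer_above_diff[y [y1 yd yx]].
  have /asboolP dh := valP h.
  have : (val h `&` K_layer d.+1)%classic y by split=> //; exact: dh yx.
  by rewrite E => -[/cd].
have up x : K_layer d x -> @K_layer n d.+1 x by exact: layerS.
apply: val_inj; apply/seteqP; split=> x.
  move=> hx; have : (val h `&` K_layer d.+1)%classic x by split=> //; exact/up/hd.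
  by rewrite E => -[].
move=> cx; have : (val c `&` K_layer d.+1)%classic x by split=> //; exact/up/cd.
by rewrite -E => -[].
Qed.

(** Distance less than 2^{-d} means agreement on every K^j with j <= d. *)
Lemma dense_eq_on_layer (R : realType) (n d : nat) (H : set (Fhat n)) (c : Fhat n) :
  @dense (Fhat_metric R n) H ->
  exists2 h, H h & (val h `&` K_layer d = val c `&` K_layer d)%classic.
Proof.
move=> Hd; have e0 : (0 < 2 ^- d :> R)%R by rewrite invr_gt0 exprn_gt0.
have cB := @nbhsx_ballx R (Fhat_metric R n) c _ e0.
(* Density is tested on open sets, hence the interior of the ball, nonempty because it contains
   [c]. *)
have [|h [/interior_subset]] := Hd (ball (c : Fhat_metric R n) (2 ^- d)%R)°%classic _ (open_interior _).
  by exists c; exact: cB.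
rewrite ballEmdist => /Fhat_dist_lt/(_ d (leqnn d))/asboolPn/contrapT E Hh.
by exists h.
Qed.

Lemma decreasing_principal (n : nat) (w : K n) :
  [set x | (x <= w)%O]%classic \in decreasing n.
Proof. by apply/asboolP => x y /= yw xy; exact: le_trans yw. Qed.

Definition principal n (w : K n) : Fhat n :=
  Sub [set x | (x <= w)%O]%classic (decreasing_principal n w).

Lemma dense_principal (R : realType) (n : nat) (H : set (Fhat n)) (w : K n) :
  @dense (Fhat_metric R n) H -> H (principal n w).
Proof.
move=> Hd; have /asboolP[d wd] := valP w.
have [h Hh E] := dense_eq_on_layer _ _ d.+1 _ (principal n w) Hd.
(* It remains to see that K^d, once it contains [w], contains all points below [w]. *)
rewrite -(eq_on_layer_isolated _ d (principal n w) h) // => x /=.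
case/orP => [xw|/eqP xw]; rewrite /K_layer /=; last by rewrite xw.
exact: (fsubsetP (layer_predS n d)) (fsubsetP (below_layer wd) _ xw).
Qed.

Lemma principal_le (n : nat) (w : K n) (b : Fhat n) :
  (principal n w <= b)%O <-> val b w.
Proof.
split=> [/subsetPset wb|bw]; first exact/wb/lexx.
by apply/subsetPset => x xw; have /asboolP db := valP b; exact: db bw xw.
Qed.

Theorem corollary6p11 (R : realType) (n : nat) (n_ge1 : (1 <= n)%N)
    (H : set (Fhat n)) (H_dense : dense_in_Fhat R H) (a : Fhat n) :
  meet_irreducible_in H a -> meet_irreducible_in (@setT (Fhat n)) a.
Proof.
case: H_dense => -[_ _ _ HU _] Hd [Ha a1 airr]; split=> //.
move=> [b1 [b2 [_ _ b1a b2a aE]]].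
have outside b : (a <= b)%O -> b <> a -> exists2 w, val b w & ~ val a w.
  move=> ab ba; apply: contrapT => nw; apply: ba; apply/le_anti/andP; split=> //.
  by apply/subsetPset => x bx; apply: contrapT => ax; apply: nw; exists x.
have [|w1 /principal_le w1b w1a] := outside b1 _ b1a; first by rewrite aE leIl.
have [|w2 /principal_le w2b w2a] := outside b2 _ b2a; first by rewrite aE leIr.
have join_neq w : ~ val a w -> (a `|` principal n w)%O <> a.
  by move=> wa E; apply: wa; apply/principal_le; rewrite -E leUr.
apply: airr; exists (a `|` principal n w1)%O, (a `|` principal n w2)%O.
split; [exact: HU Ha (dense_principal _ _ _ _ Hd)
  |exact: HU Ha (dense_principal _ _ _ _ Hd)|exact: join_neq|exact: join_neq|].
apply/le_anti/andP; split; first by rewrite lexI !leUl.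
(* A point of both joins outside [a] is below [w1] and [w2], so it lies in [b1] and [b2], whose meet
   is [a]. *)
apply/subsetPset => x [[//|xw1] [//|xw2]]; rewrite aE.
by split; [exact: subsetPset w1b _ xw1|exact: subsetPset w2b _ xw2].
Qed.
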